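(* Let $G$ and $H$ be finite simple graphs with $\operatorname{im}(G)=t$ and $\operatorname{im}(H)=r$, where $r\geq 3$. If there is a $K_r$-immersion in $H$ in which every path between terminals has an even number of pegs, then $\operatorname{im}(G\times H)\geq (t-1)(r-1)+1$.
   Context: All graphs are finite and simple. A graph $G$ has a $G'$-immersion if there is an injective map $\phi:V(G')\to V(G)$ such that for every edge $uv\in E(G')$ there is a path $P_{u,v}$ in $G$ joining $\phi(u)$ and $\phi(v)$, and these paths are pairwise edge-disjoint. The vertices $\phi(v)$ are the terminals of the immersion, and the internal vertices of the paths $P_{u,v}$ are its pegs. The immersion number $\operatorname{im}(G)$ is the largest $t$ such that $G$ has a $K_t$-immersion. The direct product $G\times H$ has vertex set $V(G)\times V(H)$, with $(g,h)$ adjacent to $(g',h')$ if and only if $gg'\in E(G)$ and $hh'\in E(H)$. *)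

(* Defs.v *)
From HB Require Import structures.
From mathcomp Require Import all_boot all_order all_algebra.
From mathcomp Require Import boolp.

Set Implicit Arguments.
Unset Strict Implicit.
Unset Printing Implicit Defensive.

Record sgraph := SGraph {
  vertex :> finType;
  adj : rel vertex;
  adj_sym : symmetric adj;
  adj_irr : irreflexive adj
}.

Section Complete.
Variable n : nat.
Definition complete_adj : rel 'I_n := fun i j => i != j.
Lemma complete_sym : symmetric complete_adj.
Proof. by move=> i j; rewrite /complete_adj eq_sym. Qed.
Lemma complete_irr : irreflexive complete_adj.
Proof. by move=> i; rewrite /complete_adj eqxx. Qed.
Definition complete := SGraph complete_sym complete_irr.
End Complete.

Section DirectProduct.
Variables G H : sgraph.
Definition dprod_adj : rel (G * H)%type :=
  fun x y => adj x.1 y.1 && adj x.2 y.2.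
Lemma dprod_sym : symmetric dprod_adj.
Proof. by move=> x y; rewrite /dprod_adj adj_sym [adj x.2 _]adj_sym. Qed.
Lemma dprod_irr : irreflexive dprod_adj.
Proof. by move=> x; rewrite /dprod_adj adj_irr. Qed.
Definition direct_product := SGraph dprod_sym dprod_irr.
End DirectProduct.

Definition path_edges (G : sgraph) (x : G) (p : seq G) : seq {set G} :=
  pairmap (fun a b => [set a; b]) x p.

(* The path attached to an edge uv of F is stored as the sequence [pegs u v]  *)
(* of its internal vertices, in order from the terminal of u to that of v;    *)
(* the whole path is [terminal u :: rcons (pegs u v) (terminal v)].  Since    *)
(* edges are unordered, the two orientations of uv carry the same path, read  *)
(* in opposite directions ([peg_rev]).  The values of [pegs] on non-adjacent  *)
(* pairs are irrelevant.  A path may pass through terminals of other          *)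
(* vertices, and different paths may share vertices.                          *)
Record immersion (F G : sgraph) := Immersion {
  terminal : F -> G;
  pegs : F -> F -> seq G;
  terminal_inj : injective terminal;
  peg_rev : forall u v : F, adj u v -> pegs v u = rev (pegs u v);
  peg_path : forall u v : F, adj u v ->
    path (@adj G) (terminal u) (rcons (pegs u v) (terminal v));
  peg_uniq : forall u v : F, adj u v ->
    uniq (terminal u :: rcons (pegs u v) (terminal v));
  peg_edge_disjoint : forall u v u' v' : F, adj u v -> adj u' v' ->
    [set u; v] != [set u'; v'] ->
    [disjoint path_edges (terminal u) (rcons (pegs u v) (terminal v))
            & path_edges (terminal u') (rcons (pegs u' v') (terminal v'))]
}.

(* Terminals are distinct, so a K_t-immersion forces t <= #|G| and the bound  *)
(* on t below loses nothing; see [im_immersion] and [im_max].                 *)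
Definition im (G : sgraph) : nat :=
  \max_(t < #|G|.+1 | `[< inhabited (immersion (complete t) G) >]) t.

Lemma im_max (G : sgraph) (t : nat) :
  inhabited (immersion (complete t) G) -> t <= im G.
Proof.
move=> It; have lt_t : t < #|G|.+1.
  by case: It => I; rewrite ltnS -[t]card_ord; apply: leq_card (@terminal_inj _ _ I).
by apply: (@leq_bigmax_cond _ _ (@nat_of_ord _) (Ordinal lt_t)); apply/asboolP.
Qed.

Lemma immersion0 (G : sgraph) : inhabited (immersion (complete 0) G).
Proof.
have F0 (T : Type) (i : complete 0) : T by case: i.
by constructor; exists (F0 _) (fun i => F0 _ i); case.
Qed.

Lemma im_immersion (G : sgraph) : inhabited (immersion (complete (im G)) G).
Proof.
have P0 : `[< inhabited (immersion (complete (@ord0 #|G|)) G) >].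
  by apply/asboolP; apply: immersion0.
rewrite /im (bigmax_eq_arg _ P0).
by case: arg_maxnP => // i /asboolP.
Qed.

(* Main.v *)
Require Import Defs.
From HB Require Import structures.
From mathcomp Require Import all_boot all_order all_algebra.
From mathcomp Require Import zify.

Set Implicit Arguments.
Unset Strict Implicit.
Unset Printing Implicit Defensive.

(* Immersion is transitive, so it suffices to immerse K_((t-1)(r-1)+1) in
   K_t x K_r, K_t x K_r in G x K_r, and G x K_r in G x H.

   For the last two, an edge of the first factor is replaced by its route, and
   the other coordinate is made to follow a proper colouring of that route whose
   ends have prescribed colours.  Two colours suffice if the route has odd
   length, and this gives G x H.  Otherwise a third colour is needed; over the
   edge xy of K_r it is z(x, y), where z is an idempotent Latin square, which
   exists because r >= 3.

   In K_t x K_r, write m = t - 1 and n = r - 1.  The terminals are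
   (oo, oo) and the (a, x) with a < m, x < n; those differing in both
   coordinates are adjacent.  The pairs (a, x), (a, y) are routed through the
   hubs (oo, z), and the pairs (a, x), (b, x) through the hubs (c, oo).  If n is
   odd, z = (x + y) / 2 modulo n.  If n is even, this works up to a perfect
   matching of "mates" x, x', where x is left with one hub g(x).  If moreover m
   is odd, mates are joined by (a, x), (oo, g(x)), (a, oo), (oo, g(x')), (a, x').
   If both are even, the unused edges are exchanged: (a, x), (a, x') are
   joined through (g(a), oo), and (a, x), (a', x) through (oo, g(x)). *)

(** * Walks whose edges determine their owner *)

Definition owned_step (F G : sgraph) (own : {set G} -> {set F}) (s : {set F})
  : rel G := fun a b => adj a b && (own [set a; b] == s).

(* [own] sends each edge of G to the edge of F that uses it, so that routes of
   distinct edges of F are edge-disjoint by construction. *)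
Definition walk_immersed (F G : sgraph) : Prop :=
  exists (f : F -> G) (own : {set G} -> {set F}), injective f /\
    forall u v, adj u v -> connect (owned_step own [set u; v]) (f u) (f v).

Lemma owned_step_sym (F G : sgraph) (own : {set G} -> {set F}) s :
  symmetric (owned_step own s).
Proof. by move=> a b; rewrite /owned_step adj_sym setUC. Qed.

(** Owners compose: an edge of [H] belongs to the edge of [G] whose route contains it, and through
    that to an edge of [F]. *)
Lemma walk_immersed_trans (F G H : sgraph) :
  walk_immersed F G -> walk_immersed G H -> walk_immersed F H.
Proof.
move=> [f [o [f_inj fP]]] [f' [o' [f'_inj f'P]]].
exists (f' \o f), (o \o o'); split; first exact: inj_comp.
move=> u v /fP /connectP [p]; rewrite /comp.
elim: p (f u) => [|b p IHp] a /= => [_ -> //|/andP [/andP [ab /eqP oab] pathp] lastp].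
apply: connect_trans _ (IHp _ pathp lastp).
apply: connect_sub (f'P _ _ ab) => c d /andP [cd /eqP ocd].
by rewrite connect1 // /owned_step cd /= ocd oab.
Qed.

Lemma imset_pair (S T : finType) (f : S -> T) a b :
  f @: [set a; b] = [set f a; f b].
Proof. by rewrite imsetU !imset_set1. Qed.

Lemma walk_immersed_hom (F G : sgraph) (f : F -> G) :
  injective f -> {homo f : u v / adj u v} -> walk_immersed F G.
Proof.
move=> f_inj f_hom; exists f, (fun E : {set G} => f @^-1: E); split=> // u v uv.
rewrite connect1 // /owned_step f_hom //=; apply/eqP/setP => w.
by rewrite !inE !(inj_eq f_inj).
Qed.

Lemma set2_inj (T : finType) (a b c d : T) :
  [set a; b] = [set c; d] -> a = c /\ b = d \/ a = d /\ b = c.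
Proof.
move=> E.
have: a \in [set c; d] by rewrite -E !inE eqxx.
have: b \in [set c; d] by rewrite -E !inE eqxx orbT.
have: c \in [set a; b] by rewrite E !inE eqxx.
have: d \in [set a; b] by rewrite E !inE eqxx orbT.
rewrite !inE => /orP [] /eqP Ed /orP [] /eqP Ec /orP [] /eqP Eb /orP [] /eqP Ea; subst; auto.
Qed.

Lemma path_edgesP (G : sgraph) (e : rel G) (x : G) p s :
  path e x p -> s \in path_edges x p -> exists a b, e a b /\ s = [set a; b].
Proof.
elim: p x => //= y p IHp x /andP [exy pathp].
by rewrite inE => /orP [/eqP -> |]; [exists x, y | apply: IHp].
Qed.

Lemma path_edges_mem (G : sgraph) (x : G) p :
  path (fun a b => [set a; b] \in path_edges x p) x p.
Proof.
(* The edge set is enlarged to a fixed [E], which does not change when the induction shortens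
   [p]. *)
suff: forall E : {set {set G}}, {subset path_edges x p <= E} ->
  path (fun a b => [set a; b] \in E) x p.
  move=> /(_ [set s in path_edges x p]) H.
  have/H: {subset path_edges x p <= [set s in path_edges x p]} by move=> s; rewrite inE.
  by apply: sub_path => a b; rewrite inE.
elim: p x => //= y p IHp x E sE; rewrite sE ?inE ?eqxx //=.
by apply: IHp => s sp; rewrite sE // inE sp orbT.
Qed.

(** Shortening turns the walks into paths, and distinct owners keep them edge-disjoint. *)
Lemma immersion_of_walks (F G : sgraph) :
  walk_immersed F G -> inhabited (immersion F G).
Proof.
move=> [f [own [f_inj fP]]].
have pegsP u v : exists p, adj u v ->
   path (owned_step own [set u; v]) (f u) (rcons p (f v)) /\
   uniq (f u :: rcons p (f v)).
  case uv: (adj u v); last by exists [::].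
  have /connectP [p pathp lastp] := fP _ _ uv.
  case/shortenP: pathp lastp => q pathq uniq_q _.
  case/lastP: q pathq uniq_q => [|q w] pathq uniq_q.
    by move=> /= /f_inj E; move: uv; rewrite E adj_irr.
  by rewrite last_rcons => E; exists q => _; rewrite E.
have {pegsP} [P PP] : exists P : F -> F -> seq G, forall u v, adj u v ->
   path (owned_step own [set u; v]) (f u) (rcons (P u v) (f v)) /\
   uniq (f u :: rcons (P u v) (f v)).
  have /boolp.choice [P PP] : forall uv : F * F, exists p, adj uv.1 uv.2 ->
    path (owned_step own [set uv.1; uv.2]) (f uv.1) (rcons p (f uv.2)) /\
    uniq (f uv.1 :: rcons p (f uv.2)) by case.
  by exists (fun u v => P (u, v)) => u v; apply: (PP (u, v)).
(* One orientation of each edge keeps its path and the other gets the reverse, as [peg_rev]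
   demands. *)
pose Q u v := if enum_rank u <= enum_rank v then P u v else rev (P v u).
have Qrev u v : adj u v -> Q v u = rev (Q u v).
  rewrite /Q; case: ltngtP => //; first by rewrite revK.
  by move=> /ord_inj/enum_rank_inj ->; rewrite adj_irr.
have QP u v : adj u v -> path (owned_step own [set u; v]) (f u) (rcons (Q u v) (f v)) /\
   uniq (f u :: rcons (Q u v) (f v)).
  move=> uv; rewrite /Q; case: leqP => _; first exact: PP.
  have [pathp uniqp] : path (owned_step own [set v; u]) (f v) (rcons (P v u) (f u)) /\
   uniq (f v :: rcons (P v u) (f u)) by apply: PP; rewrite adj_sym.
  have E : f u :: rcons (rev (P v u)) (f v) = rev (f v :: rcons (P v u) (f u)).
    by rewrite rev_cons rev_rcons.
  split; last by rewrite E rev_uniq.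
  have := rev_path (owned_step own [set v; u]) (f v) (rcons (P v u) (f u)).
  rewrite last_rcons belast_rcons rev_cons => H.
  rewrite setUC H; apply: sub_path pathp => a b.
  by rewrite owned_step_sym.
constructor; exists f Q => //.
- move=> u v /QP [pathp _]; apply: sub_path pathp => a b /andP [] //.
- by move=> u v /QP [].
move=> u v u' v' uv uv' neq; apply/pred0P => s /=; apply/negP => /andP [s1 s2].
have [[p1 _] [p2 _]] := (QP _ _ uv, QP _ _ uv').
have [a [b [/andP [_ /eqP Eab] Es]]] := path_edgesP p1 s1.
have [c [d [/andP [_ /eqP Ecd] Es']]] := path_edgesP p2 s2.
by case/eqP: neq; rewrite -Eab -Ecd -Es -Es'.
Qed.

(** * Lifting coloured routes to a product *)

Lemma path_colouring (G : sgraph) (x y : G) p : uniq (x :: rcons p y) ->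
  exists T : G -> option bool,
    [/\ T x = Some false, T y = Some true,
        path (fun a b => T a != T b) x (rcons p y) &
        ~~ odd (size p) -> forall w, T w != None].
Proof.
set q := x :: rcons p y => uniq_q.
(* Colours go by position. If [size p] is even, they alternate between [Some false] and [Some true];
   otherwise odd positions get [None] and position 0 alone gets [Some false], so the far end is
   still [Some true]. A vertex off the route has index [size q], whose label is [None] only if
   [size p] is odd. *)
pose label i := if odd i then if odd (size p) then None else Some true
  else if i == 0 then Some false else Some (odd (size p)).
have size_q : size q = (size p).+2 by rewrite /= size_rcons.
have labelE i : i < size q -> label (index (nth x q i) q) = label i.
  by move=> lt_i; rewrite index_uniq.
exists (fun w => label (index w q)); split.
- by rewrite -[x in index x _]/(nth x q 0) labelE.
- have -> : y = nth x q (size p).+1.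
    by rewrite /= nth_rcons ltnn eqxx.
  by rewrite labelE ?size_q // /label /=; case: odd.
- apply/(pathP x) => i lt_i.
  have -> : nth x (rcons p y) i = nth x q i.+1 by [].
  rewrite labelE ?labelE ?size_q -?(size_rcons p y) // 1?ltnW // /label /=.
  by case: (odd (size p)); case: i {lt_i} => [|i] //=; case: (odd i).
- rewrite /label => /negbTE even_p w; rewrite even_p.
  by case: ifP => // _; case: ifP.
Qed.

(* [T u v] properly colours the route from [u] to [v]; the third colour [None]
   is needed only when that route has even length. *)
Definition coloured_immersed (D : pred (option bool)) (t : nat) (G : sgraph) : Prop :=
  exists (f : 'I_t -> G) (own : {set G} -> {set complete t})
         (T : 'I_t -> 'I_t -> G -> option bool),
  injective f /\ forall u v : 'I_t, u < v ->
    [/\ T u v (f u) = Some false, T u v (f v) = Some true,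
        forall w, D (T u v w) &
        connect (fun a b => owned_step own [set u; v] a b && (T u v a != T u v b))
          (f u) (f v)].

Lemma coloured_immersion (D : pred (option bool)) (t : nat) (G : sgraph)
    (I : immersion (complete t) G) :
  D (Some false) -> D (Some true) ->
  (forall u v : complete t, adj u v -> odd (size (pegs I u v)) -> D None) ->
  coloured_immersed D t G.
Proof.
move=> D0 D1 DN.
pose edges u v := path_edges (terminal I u) (rcons (pegs I u v) (terminal I v)).
pose own (s : {set G}) : {set complete t} :=
  if [pick uv | adj uv.1 uv.2 && (s \in edges uv.1 uv.2)] is Some uv
  then [set uv.1; uv.2] else set0.
have ownP u v s : adj u v -> s \in edges u v -> own s = [set u; v].
  move=> uv s_uv; rewrite /own; case: pickP => [[u' v'] /= /andP [uv' s_uv']|].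
    apply/eqP/negPn/negP => neq.
    by have /pred0P /(_ s) := peg_edge_disjoint I uv' uv neq; rewrite /= s_uv' s_uv.
  by move=> /(_ (u, v)) /negP []; apply/andP.
have TP (uv : 'I_t * 'I_t) : exists T : G -> option bool, uv.1 != uv.2 ->
  [/\ T (terminal I uv.1) = Some false, T (terminal I uv.2) = Some true,
      forall w, D (T w) &
      connect (fun a b => owned_step own [set uv.1; uv.2] a b && (T a != T b))
          (terminal I uv.1) (terminal I uv.2)].
  case: uv => u v /=; have [_|uv] := eqVneq u v; first by exists (fun=> None).
  have uv' : @adj (complete t) u v := uv.
  have [T [T0 T1 Tpath TN]] := path_colouring (peg_uniq I uv').
  exists T; split=> // [w|].
    have := TN^~ w; case: (T w) => [[]|] // DNw.
    by apply: (DN _ _ uv'); apply/negPn/negP => /DNw.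
  apply/connectP; exists (rcons (pegs I u v) (terminal I v)); last by rewrite last_rcons.
  have memp : path (fun a b => [set a; b] \in edges u v)
      (terminal I u) (rcons (pegs I u v) (terminal I v)) by exact: path_edges_mem.
  move: (peg_path I uv') memp.
  elim: (rcons _ _) (terminal I u) Tpath => //= b q IHq a.
  move=> /andP [Tab /IHq {}IHq] /andP [ab /IHq {}IHq] /andP [/(ownP _ _ _ uv') Eab /IHq ->].
  by rewrite /owned_step ab Eab eqxx Tab.
have [T {}TP] := boolp.choice TP.
exists (terminal I), own, (fun u v => T (u, v)); split; first exact: (@terminal_inj _ _ I).
by move=> u v lt_uv; apply: (TP (u, v)); rewrite neq_ltn lt_uv.
Qed.

(** A lifted edge determines its owner: its projection gives [u] and [v], the order [u < v] fixes
    the colouring, and the distinct colours of its two ends give [x] and [y] by the last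
    hypothesis. *)
Lemma coloured_product (D : pred (option bool)) (t : nat) (G X : sgraph)
    (col : X -> X -> option bool -> X) :
  coloured_immersed D t G ->
  (forall x y, adj x y -> col x y (Some false) = x) ->
  (forall x y, adj x y -> col x y (Some true) = y) ->
  (forall x y c c', adj x y -> D c -> D c' -> c != c' ->
     adj (col x y c) (col x y c')) ->
  (forall x y x' y' c c', adj x y -> adj x' y' -> D c -> D c' -> c != c' ->
     col x y c = col x' y' c -> col x y c' = col x' y' c' -> x = x' /\ y = y') ->
  walk_immersed (direct_product (complete t) X) (direct_product G X).
Proof.
move=> [f [own [T [f_inj fP]]]] col0 col1 col_adj col_inj.
pose F := direct_product (complete t) X.
pose holds (E : {set direct_product G X}) (q : F * F) :=
  [&& q.1.1 < q.2.1, adj q.1.2 q.2.2, own (fst @: E) == [set q.1.1; q.2.1] &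
      [forall w in E, w.2 == col q.1.2 q.2.2 (T q.1.1 q.2.1 w.1)]].
pose own' E : {set F} := if [pick q | holds E q] is Some q then [set q.1; q.2] else set0.
exists (fun ux => (f ux.1, ux.2)), own'; split.
  by move=> [u x] [v y] [] /f_inj -> ->.
suff oriented (u v : 'I_t) x y : u < v -> adj x y ->
    connect (owned_step own' [set (u, x); (v, y)]) (f u, x) (f v, y).
  move=> [u x] [v y] /andP [/= uv xy].
  have : u != v := uv; rewrite neq_ltn => /orP [] lt_uv; first exact: oriented.
  rewrite setUC; apply: etrans (sym_connect_sym (owned_step_sym own' _) _ _) _.
  by apply: oriented; rewrite // adj_sym.
move=> lt_uv xy; have [Tu Tv TD /connectP [p pathp lastp]] := fP _ _ lt_uv.
pose lift w : direct_product G X := (w, col x y (T u v w)).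
have -> : (f u, x) = lift (f u) by rewrite /lift Tu col0.
have -> : (f v, y) = lift (f v) by rewrite /lift Tv col1.
rewrite lastp; elim: p (f u) pathp {lastp} => //= b p IHp a.
move=> /andP [/andP [/andP [ab /eqP oab] Tab] /IHp]; apply: connect_trans.
rewrite connect1 // /owned_step; apply/andP; split.
  by apply/andP; split=> //=; apply: col_adj.
have fstE : fst @: [set lift a; lift b] = [set a; b] by rewrite imset_pair.
rewrite /own'; case: pickP => [[[u' x'] [v' y']]|].
  move=> /and4P [/= lt_uv' xy' /eqP]; rewrite fstE oab => /set2_inj Euv.
  have [??] : u = u' /\ v = v' by case: Euv => -[??] //; subst; lia.
  subst u' v' => /forall_inP cE.
  have := cE _ (set21 _ _); have := cE _ (set22 _ _).
  rewrite /lift /= => /eqP Eb /eqP Ea.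
  by have [-> ->] := col_inj _ _ _ _ _ _ xy xy' (TD _) (TD _) Tab Ea Eb.
move/(_ ((u, x), (v, y))); rewrite /holds /= lt_uv xy fstE oab eqxx /=.
move/negbT/negP; case; apply/forall_inP => w.
by rewrite !inE => /orP [] /eqP ->.
Qed.

(** * Halving modulo an odd number, and Latin squares *)

Lemma ord_op (n : nat) (s : nat -> nat -> nat) :
  (forall x y, x < n -> y < n -> x != y -> s x y < n) ->
  exists z : 'I_n -> 'I_n -> 'I_n, forall x y, x != y -> z x y = s x y :> nat.
Proof.
move=> s_lt; exists (fun x y : 'I_n => insubd x (s x y)) => x y neq_xy.
by rewrite insubdK // -topredE /= s_lt.
Qed.

(* The solution w < n of 2 w = k modulo an odd n, for k < 2 n. *)
Definition halfmod (n k : nat) :=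
  if odd k then if k < n then (k + n)./2 else (k - n)./2 else k./2.

Lemma halfmodP (n k : nat) : odd n -> k < n.*2 -> halfmod n k < n /\
  ((halfmod n k).*2 = k \/ (halfmod n k).*2 = k + n \/ (halfmod n k).*2 + n = k).
Proof.
by move=> odd_n lt_k; rewrite /halfmod; do ?case: ifP; lia.
Qed.

Ltac halfmod_lia odd_n :=
  repeat match goal with |- context [halfmod ?n ?k] =>
    let w := fresh "w" in let H := fresh "H" in
    have H := @halfmodP n k odd_n; move: (halfmod n k) H => w H
  end; lia.

(** The diagonal is left out; idempotence survives in the first two clauses, since [x] and [y] are
    already taken in row [x] and column [y]. *)
Lemma idempotent_latin (n : nat) : 2 < n ->
  exists z : 'I_n -> 'I_n -> 'I_n, forall x y, x != y ->
    [/\ z x y != x, z x y != y,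
        forall y', x != y' -> z x y = z x y' -> y = y' &
        forall x', x' != y -> z x y = z x' y -> x = x'].
Proof.
move=> n_gt2.
suff [s sP] : exists s : nat -> nat -> nat, forall x y, x < n -> y < n -> x <> y ->
    [/\ s x y < n, s x y <> x, s x y <> y,
        forall y', y' < n -> x <> y' -> s x y = s x y' -> y = y' &
        forall x', x' < n -> x' <> y -> s x y = s x' y -> x = x'].
  have [|z zE] := @ord_op n s.
    by move=> x y ltx lty /eqP neq; case: (sP x y).
  exists z => x y neq_xy; have /eqP neq_xy' : (x : nat) != y by [].
  have [_ sx sy srow scol] := sP _ _ (ltn_ord x) (ltn_ord y) neq_xy'; split.
  - by rewrite -val_eqE /= zE //; apply/eqP.
  - by rewrite -val_eqE /= zE //; apply/eqP.
  - move=> y' neq /(congr1 val) /=; rewrite !zE // => /srow E.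
    by apply/val_inj/E => //; apply/eqP.
  - move=> x' neq /(congr1 val) /=; rewrite !zE // => /scol E.
    by apply/val_inj/E => //; apply/eqP.
case odd_n: (odd n).
  exists (fun x y => halfmod n (x + y)) => x y ltx lty neq_xy.
  by split; try (move=> ? ? ?); halfmod_lia odd_n.
(* Prolongation of the square of odd order N: the entries at (x, x + 1) form
   a transversal, which moves to the new row and column. *)
have {odd_n} [N odd_N nE] : exists2 N, odd N & n = N.+1 by exists n.-1; lia.
pose nxt x := if x.+1 == N then 0 else x.+1.
pose prv x := if x == 0 then N.-1 else x.-1.
exists (fun x y => if x == N then halfmod N (prv y + y)
  else if y == N then halfmod N (x + nxt x)
  else if y == nxt x then N else halfmod N (x + y)) => x y ltx lty neq_xy.
split; try (move=> ? ? ?); rewrite /nxt /prv; do ?case: ifP; halfmod_lia odd_N.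
Qed.

(** * Hub designs *)

(* In the fibre over a vertex of the other factor, the route from [x] to [y]
   leaves [x] through the hub numbered [hub x y].  The routes of [x] to [y] and
   of [y] to [x] meet at once unless [x] and [y] are mates; [mate x = x] means
   that [x] has no mate. *)
Record design (n : nat) := Design {
  hub : 'I_n -> 'I_n -> 'I_n;
  mate : 'I_n -> 'I_n;
  mateK : involutive mate;
  hub_neq : forall x y, x != y -> hub x y != x;
  hub_inj : forall x y y', x != y -> x != y' -> hub x y = hub x y' -> y = y';
  hub_sym : forall x y, x != y -> y != mate x -> hub x y = hub y x;
  hub_mate_inj : forall x y, mate x != x -> mate y != y ->
    hub x (mate x) = hub y (mate y) -> x = y
}.

Lemma odd_design (n : nat) : odd n -> exists S : design n, mate S =1 id.
Proof.
move=> odd_n; have [|z zE] := @ord_op n (fun x y => halfmod n (x + y)).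
  by move=> x y ltx lty neq_xy; halfmod_lia odd_n.
have neq (x y : 'I_n) : x != y -> (x : nat) <> y by move/eqP=> neq /val_inj.
unshelve eexists (@Design n z id _ _ _ _ _) => //.
- move=> x y neq_xy; rewrite -val_eqE /= zE //; move: (neq _ _ neq_xy).
  by have := ltn_ord x; have := ltn_ord y; halfmod_lia odd_n.
- move=> x y y' xy xy' /(congr1 val) /=; rewrite !zE // => E; apply/val_inj => /=.
  move: E (neq _ _ xy) (neq _ _ xy').
  by have := ltn_ord x; have := ltn_ord y; have := ltn_ord y'; halfmod_lia odd_n.
- by move=> x y xy _; apply/val_inj; rewrite /= zE // zE 1?eq_sym // addnC.
- by move=> x y; rewrite eqxx.
Qed.

(* The elements of Z_N, with N = 2 h + 1 odd, and a point at infinity, encoded as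
   N.  Start from the 1-factorization of the complete graph in which x, y have
   colour x + y + 1 and x, N have colour 2 x + 1.  Colour 0 is the set of mates.
   From each other colour take out the edge of the path 0, 1, ..., N - 1, and
   colour this path alternately with two new colours.  Each of the resulting
   N + 1 colours misses two vertices, and is named after one of them. *)
Section EvenDesign.
Variable h : nat.
Local Notation N := h.*2.+1.

(* The solution w of 2 w + 1 = k modulo N. *)
Definition mid (k : nat) :=
  if odd k then k./2 else if k < h.*2 then k./2 + h else k./2 - h.+1.

Lemma midP k : k != h.*2 -> k < N.*2.-1 -> mid k < N.-1 /\
  ((mid k).*2.+1 = k \/ (mid k).*2.+1 = k + N \/ (mid k).*2.+1 + N = k).
Proof. by rewrite /mid; do ?case: ifP; lia. Qed.

(** Colour 0 pairs numbers of sum [N - 1]; as [h] would be paired with itself, it is paired with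
    infinity. *)
Definition emate x := if x == N then h else if x == h then N else N.-1 - x.

(** The colour of [x], [y] is named after the [w] whose edge [w], [w + 1] it lost, so 2 w + 1 = x +
    y modulo [N]. The new colours are [N] and [N - 1], for odd and even [w]. Besides its own colour,
    [x] is missed by [x - 1], or by [N] if [x = 0]: this is the hub left for its mate. *)
Definition ehub x y :=
  if y == emate x then if x == 0 then N else x.-1
  else if x == N then mid y.*2
  else if y == N then mid x.*2
  else if y == x.+1 then if odd x then N else N.-1
  else if x == y.+1 then if odd y then N else N.-1
  else mid (x + y).

Ltac mid_lia := 
  repeat match goal with |- context [mid ?k] =>
    let w := fresh "w" in let H := fresh "H" in
    have H := @midP k; move: (mid k) H => w H
  end; lia.


Lemma emateP x : x < N.+1 -> emate x < N.+1 /\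
  (x = N /\ emate x = h \/ x = h /\ emate x = N \/
   x < N /\ x <> h /\ x + emate x = h.*2).
Proof.
by rewrite /emate => ltx; do ?case: eqP; lia.
Qed.

Ltac ehub_lia x :=
  let m := fresh "m" in let ltx := fresh "ltx" in move=> ltx; move: (emateP ltx); rewrite /ehub;
  move: (emate x) => m [ltm [[? ?]|[[? ?]|[? [? ?]]]]]; subst; do ?case: ifP => ?;  mid_lia.

Lemma ehub_lt x y : x < N.+1 -> y < N.+1 -> x <> y -> ehub x y < N.+1.
Proof. by ehub_lia x. Qed.

Lemma ehub_neq x y : x < N.+1 -> y < N.+1 -> x <> y -> ehub x y <> x.
Proof. by ehub_lia x. Qed.

Lemma ehub_sym x y : x < N.+1 -> y < N.+1 -> x <> y -> y <> emate x -> ehub x y = ehub y x.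
Proof.
rewrite /ehub (addnC y) => ltx lty neq_xy mxy.
have -> : (y == emate x) = false by lia.
have -> : (x == emate y) = false by move: mxy; rewrite /emate; do ?case: ifP; lia.
by do ?case: ifP; rewrite //; lia.
Qed.

(** Linear form of the cases for finite [x]. In [EhubMid], [y'] replaces an infinite [y] by [x],
    because [x], [N] has the colour of the sum [x + x]. *)
Variant ehub_spec x y : nat -> Prop :=
| EhubMate of y = emate x & 0 < x : ehub_spec x y x.-1
| EhubMate0 of y = emate x & x = 0 : ehub_spec x y N
| EhubNext r of y <> emate x & y = x.+1 & r + odd x = N.-1 + (odd x).*2 : ehub_spec x y r
| EhubPrev r of y <> emate x & x = y.+1 & r + odd x = N : ehub_spec x y r
| EhubMid r y' of y <> emate x & (y = N /\ y' = x) \/ (y = y' /\ x <> y') & y' < N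
  & x.+1 <> y' & y'.+1 <> x & r < N.-1
  & r.*2.+1 = x + y' \/ r.*2.+1 = x + y' + N \/ r.*2.+1 + N = x + y' : ehub_spec x y r.

Lemma ehubP x y : x < N -> y < N.+1 -> x <> y -> ehub_spec x y (ehub x y).
Proof.
move=> ltx lty neq_xy; have /emateP [_] : x < N.+1 by rewrite ltnS ltnW.
rewrite /ehub => mx; case: eqP => [yE|neq].
  by case: eqP => [|/eqP]; [apply: EhubMate0 | rewrite -lt0n; apply: EhubMate].
have -> : (x == N) = false by lia.
case: eqP => [yE|neqN].
  by apply: (@EhubMid _ _ _ x); rewrite ?addnn //; try (left; done); try lia;
     have := @midP x.*2; lia.
case: eqP => [yE|neqS]; first by apply: EhubNext => //; case: (odd x); lia.
case: eqP => [yE|neqP]; first by apply: EhubPrev => //; rewrite yE /=; case: (odd y); lia.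
apply: (@EhubMid _ _ _ y) => //; try lia;
     have := @midP (x + y); lia.
Qed.

Lemma ehub_inj x y y' : x < N.+1 -> y < N.+1 -> y' < N.+1 -> x <> y -> x <> y' ->
  ehub x y = ehub x y' -> y = y'.
Proof.
rewrite leq_eqVlt => /orP [/eqP [xN] | ltx] lty lty' neq neq'.
  rewrite xN in neq neq' *; rewrite /ehub /emate eqxx /=; case: eqP => [->|?]; case: eqP => [->|?] //;
    mid_lia.
by case: (ehubP ltx lty neq); case: (ehubP ltx lty' neq') => *; lia.
Qed.
End EvenDesign.

Lemma even_design (n : nat) : ~~ odd n ->
  exists S : design n, forall x, mate S x != x.
Proof.
have [->|n_gt0] := posnP n; first by unshelve eexists (@Design 0 (fun x _ => x) id _ _ _ _ _); case.
move=> even_n; have {n_gt0 even_n} [h ->] : exists h, n = h.*2.+2 by exists n.-2./2; lia.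
have [|z zE] := @ord_op h.*2.+2 (ehub h).
  by move=> x y ltx lty /eqP; apply: ehub_lt.
have m_lt (x : 'I_h.*2.+2) : emate h x < h.*2.+2 by have [] := emateP (ltn_ord x).
pose m (x : 'I_h.*2.+2) := Ordinal (m_lt x).
have mK : involutive m.
  by move=> x; apply: val_inj; rewrite /= /emate; have := ltn_ord x; do ?case: ifP; lia.
have m_neq x : m x != x.
  by rewrite -val_eqE /= /emate; do ?case: ifP; lia.
have neq (x y : 'I_h.*2.+2) : x != y -> (x : nat) <> y by move/eqP=> neq /val_inj.
unshelve eexists (@Design _ z m mK _ _ _ _) => //.
- move=> x y xy; rewrite -val_eqE /= zE //; apply/eqP.
  by apply: ehub_neq => //; apply: neq.
- move=> x y y' xy xy' /(congr1 val); rewrite /= !zE // => /ehub_inj E.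
  by apply/val_inj/E => //; apply: neq.
- move=> x y xy /neq yx; apply/val_inj; rewrite /= zE // zE 1?eq_sym //.
  by apply: ehub_sym => //; apply: neq.
- move=> x y mx my /(congr1 val); rewrite /= !zE 1?eq_sym // /ehub !eqxx => E.
  by apply/val_inj; have := ltn_ord x; have := ltn_ord y; move: E => /=; do ?case: ifP; lia.
Qed.

(** * Routing in the product of two cliques *)

Lemma neq_sym (T : eqType) : symmetric (fun x y : T => x != y).
Proof. by move=> x y; rewrite eq_sym. Qed.

Lemma neq_irr (T : eqType) : irreflexive (fun x y : T => x != y).
Proof. by move=> x; rewrite eqxx. Qed.

Definition clique (T : finType) := SGraph (@neq_sym T) (@neq_irr T).

Section Routing.
Variables A B : finType.
Let F := clique (option (A * B)).
Let K := direct_product (clique (option A)) (clique (option B)).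
Variables (ownR : A -> B -> B -> {set F}) (ownC : A -> B -> A -> {set F}).
Variable (ownH : A -> B -> {set F}).

(* The terminals are the (Some a, Some x) and (None, None); the hubs of the rows
   are the (None, Some z), and those of the columns the (Some c, None). *)
Definition edge_owner (p q : K) : {set F} :=
  match p, q with
  | (Some a, Some x), (Some b, Some y) => [set Some (a, x); Some (b, y)]
  | (Some a, Some x), (None, None) | (None, None), (Some a, Some x) =>
      [set Some (a, x); None]
  | (Some a, Some x), (None, Some z) | (None, Some z), (Some a, Some x) => ownR a x z
  | (Some a, Some x), (Some c, None) | (Some c, None), (Some a, Some x) => ownC a x c
  | (Some c, None), (None, Some z) | (None, Some z), (Some c, None) => ownH c z
  | _, _ => set0
  end.

Definition owner (E : {set K}) : {set F} :=
  if [pick pq | E == [set pq.1; pq.2]] is Some pq then edge_owner pq.1 pq.2 else set0.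

Lemma ownerE p q : owner [set p; q] = edge_owner p q.
Proof.
have sym p' q' : edge_owner p' q' = edge_owner q' p'.
  by case: p' q' => [[a|] [x|]] [[b|] [y|]] //=; rewrite setUC.
rewrite /owner; case: pickP => [[p' q'] /= /eqP /set2_inj [[-> ->]|[-> ->]]|] //.
by move/(_ (p, q)); rewrite eqxx.
Qed.

Lemma connect_owned s (p q : K) :
  adj p q -> edge_owner p q = s -> connect (owned_step owner s) p q.
Proof. by move=> pq oE; rewrite connect1 // /owned_step pq ownerE oE eqxx. Qed.

Lemma clique_routing :
  (forall a x y, x != y -> connect (owned_step owner [set Some (a, x); Some (a, y)])
     (Some a, Some x) (Some a, Some y)) ->
  (forall a b x, a != b -> connect (owned_step owner [set Some (a, x); Some (b, x)])
     (Some a, Some x) (Some b, Some x)) ->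
  walk_immersed F K.
Proof.
move=> row col; pose f (u : F) : K := if u is Some (a, x) then (Some a, Some x) else (None, None).
exists f, owner; split; first by move=> [[a x]|] [[b y]|] //= [-> ->].
move=> [[a x]|] [[b y]|] //= uv; try by apply: connect_owned => //=; rewrite setUC.
have [ab|ab] := eqVneq a b; first by subst b; apply: row; apply: contra_neq uv => ->.
have [xy|xy] := eqVneq x y; first by subst y; apply: col.
by apply: connect_owned => //; apply/andP.
Qed.
End Routing.

Section Decode.
Variables (n : nat) (S : design n).

(** Decoding a hub: the owner of an edge from a terminal to a hub must be read off the edge
    alone. *)
Definition partner x z := odflt x [pick y | (x != y) && (hub S x y == z)].

Lemma partnerE x y : x != y -> partner x (hub S x y) = y.
Proof.
move=> xy; rewrite /partner; case: pickP => [y' /andP [xy' /eqP] /= |/(_ y)].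
  exact: hub_inj.
by rewrite xy eqxx.
Qed.

Definition mate_user z :=
  odflt z [pick x | (mate S x != x) && (hub S x (mate S x) == z)].

Lemma mate_userE x : mate S x != x -> mate_user (hub S x (mate S x)) = x.
Proof.
move=> mx; rewrite /mate_user; case: pickP => [x' /andP [mx' /eqP] /= |/(_ x)].
  exact: hub_mate_inj.
by rewrite mx eqxx.
Qed.
End Decode.

(** Edges between hubs serve only the detours of mates in rows: the column hub tells the row, and
    the row hub tells which mate, by [hub_mate_inj]. *)
Lemma clique_product_no_mate (m n : nat) (SA : design m) (SB : design n) :
  mate SA =1 id ->
  walk_immersed (clique (option ('I_m * 'I_n)))
    (direct_product (clique (option 'I_m)) (clique (option 'I_n))).
Proof.
move=> mA.
apply: (@clique_routing _ _
  (fun a x z => [set Some (a, x); Some (a, partner SB x z)])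
  (fun a x c => [set Some (a, x); Some (partner SA a c, x)])
  (fun c z => [set Some (c, mate_user SB z); Some (c, mate SB (mate_user SB z))])).
- move=> a x y xy; have yx : y != x by rewrite eq_sym.
  have xR : Some x != Some (hub SB x y) by rewrite eq_sym; apply: hub_neq.
  have Ry : Some (hub SB y x) != Some y by apply: hub_neq.
  have [yE|ny] := eqVneq y (mate SB x).
    have mx : mate SB x != x by rewrite -yE.
    have my : mate SB y != y by rewrite yE mateK -yE.
    have xE : mate SB y = x by rewrite yE mateK.
    apply: (@connect_trans _ _ (None, Some (hub SB x y))).
      by apply: connect_owned; rewrite /= ?partnerE //; apply/andP.
    apply: (@connect_trans _ _ (Some a, None)).
      by apply: connect_owned; rewrite //= yE mate_userE.
    apply: (@connect_trans _ _ (None, Some (hub SB y x))).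
      by apply: connect_owned; rewrite //= -{1 2}xE mate_userE // xE setUC.
    by apply: connect_owned; rewrite /= ?partnerE // ?(setUC [set Some (a, y)]) //; apply/andP.
  apply: (@connect_trans _ _ (None, Some (hub SB x y))).
    by apply: connect_owned; rewrite /= ?partnerE //; apply/andP.
  rewrite hub_sym //.
  by apply: connect_owned; rewrite /= ?partnerE // ?(setUC [set Some (a, y)]) //; apply/andP.
- move=> a b x ab; have ba : b != a by rewrite eq_sym.
  have aC : Some a != Some (hub SA a b) by rewrite eq_sym; apply: hub_neq.
  have Cb : Some (hub SA b a) != Some b by apply: hub_neq.
  apply: (@connect_trans _ _ (Some (hub SA a b), None)).
    by apply: connect_owned; rewrite /= ?partnerE //; apply/andP.
  rewrite hub_sym ?mA //.
  by apply: connect_owned; rewrite /= ?partnerE // ?(setUC [set Some (b, x)]) //; apply/andP.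
Qed.

(** Row mates avoid the row hubs, so the edge from [(a, x)] to the hub [x] reserved for its mate is
    free for the column mates at [(a, x)]; the converse is symmetric. *)
Lemma clique_product_all_mate (m n : nat) (SA : design m) (SB : design n) :
  (forall a, mate SA a != a) -> (forall x, mate SB x != x) ->
  walk_immersed (clique (option ('I_m * 'I_n)))
    (direct_product (clique (option 'I_m)) (clique (option 'I_n))).
Proof.
move=> mA mB.
apply: (@clique_routing _ _
  (fun a x z => let y := partner SB x z in
     [set Some (a, x); if y == mate SB x then Some (mate SA a, x) else Some (a, y)])
  (fun a x c => let b := partner SA a c in
     [set Some (a, x); if b == mate SA a then Some (a, mate SB x) else Some (b, x)])
  (fun _ _ => set0)).
- move=> a x y xy; have yx : y != x by rewrite eq_sym.
  have [yE|ny] := eqVneq y (mate SB x).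
    have am : a != mate SA a by rewrite eq_sym.
    have aC : Some a != Some (hub SA a (mate SA a)) by rewrite eq_sym; apply: hub_neq.
    have Ca : Some (hub SA a (mate SA a)) != Some a by rewrite eq_sym.
    apply: (@connect_trans _ _ (Some (hub SA a (mate SA a)), None)).
      by apply: connect_owned; rewrite /= ?partnerE ?eqxx -?yE //; apply/andP.
    apply: connect_owned; first by apply/andP.
    by rewrite /= partnerE // eqxx yE mateK setUC.
  have xR : Some x != Some (hub SB x y) by rewrite eq_sym; apply: hub_neq.
  have Ry : Some (hub SB y x) != Some y by apply: hub_neq.
  have nx : x != mate SB y by apply: contra_neq ny => ->; rewrite mateK.
  apply: (@connect_trans _ _ (None, Some (hub SB x y))).
    by apply: connect_owned; rewrite /= ?partnerE ?(negbTE ny) //; apply/andP.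
  rewrite hub_sym //; apply: connect_owned; first by apply/andP.
  by rewrite /= partnerE // (negbTE nx) setUC.
- move=> a b x ab; have ba : b != a by rewrite eq_sym.
  have [bE|nb] := eqVneq b (mate SA a).
    have xm : x != mate SB x by rewrite eq_sym.
    have xR : Some x != Some (hub SB x (mate SB x)) by rewrite eq_sym; apply: hub_neq.
    have Rx : Some (hub SB x (mate SB x)) != Some x by rewrite eq_sym.
    apply: (@connect_trans _ _ (None, Some (hub SB x (mate SB x)))).
      by apply: connect_owned; rewrite /= ?partnerE ?eqxx -?bE //; apply/andP.
    apply: connect_owned; first by apply/andP.
    by rewrite /= partnerE // eqxx bE mateK setUC.
  have aC : Some a != Some (hub SA a b) by rewrite eq_sym; apply: hub_neq.
  have Cb : Some (hub SA b a) != Some b by apply: hub_neq.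
  have na : a != mate SA b by apply: contra_neq nb => ->; rewrite mateK.
  apply: (@connect_trans _ _ (Some (hub SA a b), None)).
    by apply: connect_owned; rewrite /= ?partnerE ?(negbTE nb) //; apply/andP.
  rewrite hub_sym //; apply: connect_owned; first by apply/andP.
  by rewrite /= partnerE // (negbTE na) setUC.
Qed.

(** * Assembling the immersions *)

Lemma direct_product_swap (G H : sgraph) :
  walk_immersed (direct_product G H) (direct_product H G).
Proof.
apply: (@walk_immersed_hom (direct_product G H) (direct_product H G) (fun p => (p.2, p.1))).
  by move=> [a b] [c d] [-> ->].
by move=> [a b] [c d] /andP [? ?]; apply/andP.
Qed.

Lemma design_exists n : exists S : design n,
  if odd n then mate S =1 id else forall x, mate S x != x.
Proof.
case odd_n: (odd n); first exact: odd_design.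
by apply: even_design; rewrite odd_n.
Qed.

Lemma direct_product_hom (G G' H H' : sgraph) (f : G -> G') (g : H -> H') :
  injective f -> injective g -> {homo f : u v / adj u v} -> {homo g : u v / adj u v} ->
  walk_immersed (direct_product G H) (direct_product G' H').
Proof.
move=> fi gi fh gh.
apply: (@walk_immersed_hom (direct_product G H) (direct_product G' H')
  (fun p => (f p.1, g p.2))).
  by move=> [a b] [c d] [/fi -> /gi ->].
by move=> [a b] [c d] /andP [/= /fh ? /gh ?]; apply/andP.
Qed.

Lemma inj_ord (T : finType) n : #|T| = n -> exists f : T -> 'I_n, injective f.
Proof. by move=> <-; exists enum_rank; apply: enum_rank_inj. Qed.

Lemma clique_product (m n : nat) :
  walk_immersed (complete (m * n).+1) (direct_product (complete m.+1) (complete n.+1)).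
Proof.
have cardO : #|{: option ('I_m * 'I_n)}| = (m * n).+1.
  by rewrite card_option card_prod !card_ord.
apply: (@walk_immersed_trans _ (clique (option ('I_m * 'I_n)))).
  pose f (i : 'I_(m * n).+1) : option ('I_m * 'I_n) := enum_val (cast_ord (esym cardO) i).
  have f_inj : injective f by move=> u v /enum_val_inj /cast_ord_inj.
  apply: (@walk_immersed_hom (complete _) (clique _) f) => // u v uv.
  by rewrite /= (inj_eq f_inj).
apply: (@walk_immersed_trans _
  (direct_product (clique (option 'I_m)) (clique (option 'I_n)))).
  have [[SA SAP] [SB SBP]] := (design_exists m, design_exists n).
  case odd_m: (odd m) SAP => SAP; first exact: clique_product_no_mate SAP.
  case odd_n: (odd n) SBP => SBP; last exact: clique_product_all_mate SAP SBP.
  (* Only [n] is odd here, so the factors are exchanged to put the one without mates first. *)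
  apply: walk_immersed_trans (direct_product_swap _ _).
  apply: walk_immersed_trans (clique_product_no_mate SA SBP).
  apply: (@walk_immersed_hom (clique _) (clique _) (omap (fun p => (p.2, p.1)))).
    by move=> [[a x]|] [[b y]|] //= [-> ->].
  by move=> [[a x]|] [[b y]|] //=; apply: contra_neq => -[-> ->].
have [f f_inj] := @inj_ord (option 'I_m) m.+1 (etrans (card_option _) (congr1 S (card_ord m))).
have [g g_inj] := @inj_ord (option 'I_n) n.+1 (etrans (card_option _) (congr1 S (card_ord n))).
by apply: (@direct_product_hom (clique _) (complete _) (clique _) (complete _) f g) => // u v uv;
  rewrite /= /complete_adj (inj_eq f_inj, inj_eq g_inj).
Qed.

(** Along an odd number of edges, alternating between [x] and [y] ends at [y], so the third colour
    never occurs. *)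
Lemma even_pegs_product (G H : sgraph) (r : nat) (I : immersion (complete r) H) :
  (forall u v : complete r, adj u v -> ~~ odd (size (pegs I u v))) ->
  walk_immersed (direct_product G (complete r)) (direct_product G H).
Proof.
move=> evenI; apply: walk_immersed_trans (direct_product_swap _ _) _.
apply: walk_immersed_trans (direct_product_swap _ _).
apply: (@coloured_product (fun c => c != None) _ _ _
  (fun x y c => if c == Some true then y else x)) => //=.
- by apply: (@coloured_immersion _ _ _ I) => // u v /evenI /negbTE ->.
- by move=> x y [[]|] [[]|] //= xy _ _ _; rewrite // adj_sym.
- by move=> x y x' y' [[]|] [[]|].
Qed.

Lemma immersion_product (G : sgraph) (t r : nat) (I : immersion (complete t) G) :
  2 < r ->
  walk_immersed (direct_product (complete t) (complete r)) (direct_product G (complete r)).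
Proof.
move=> /idempotent_latin [z zP].
apply: (@coloured_product predT _ _ (complete r)
  (fun x y c => if c is Some b then if b then y else x else z x y)) => //=.
- exact: (coloured_immersion (I := I)).
- move=> x y c c' xy _ _; have [zx zy _ _] := zP _ _ xy.
  by case: c c' => [[]|] [[]|] //= _; rewrite /complete_adj // eq_sym.
- move=> x y x' y' c c' xy xy' _ _.
  (* One end together with the third colour determines the other end, by injectivity of a row or
     column of [z]. *)
  have [_ _ zrow zcol] := zP _ _ xy.
  case: c c' => [[]|] [[]|] //= _ E E'; subst => //.
  all: by split=> //; first [apply: zrow | apply: zcol].
Qed.

Theorem theorem24 (G H : sgraph) (t r : nat)
  (hG : im G = t) (hH : im H = r) (hr : 3 <= r)
  (heven : exists I : immersion (complete r) H,
     forall u v : complete r, adj u v -> ~~ odd (size (pegs I u v))) :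
  ((t%:Z - 1) * (r%:Z - 1) + 1 <= (im (direct_product G H))%:Z)%R.
Proof.
case: heven => J evenJ.
have [IG] := im_immersion G; move: IG; rewrite hG => IG.
(* For [t = 0] the left side is [2 - r], which is negative. *)
case: t {hG} IG => [|m] IG; first by lia.
case: r {hH} hr J evenJ => [//|n] hr J evenJ.
suff : (m * n).+1 <= im (direct_product G H) by nia.
apply/im_max/immersion_of_walks.
apply: walk_immersed_trans (clique_product m n) _.
apply: walk_immersed_trans (immersion_product IG hr) _.
exact: even_pegs_product evenJ.
Qed.
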